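(* Let $F$ be a field with $\operatorname{char} F\ne 2$, and let $R$ be a Rota--Baxter operator on the matrix algebra $M_2(F)$ of nonzero weight $\Delta$. Then either $R$ is splitting, or there is an automorphism $\psi$ of the algebra $M_2(F)$ such that the operator $P=\psi^{-1}(\Delta^{-1}R)\psi$ (a Rota--Baxter operator of weight $1$) has the following form: either $P(e_{12})=0$ and $P(e_{21})=-e_{21}$, or $P(e_{21})=0$ and $P(e_{12})=-e_{12}$; and $P$ maps the subalgebra $D=\mathrm{span}\{e_{11},e_{22}\}$ of diagonal matrices into itself, its restriction to $D$ being a Rota--Baxter operator of weight $1$ on $D$.
   Context: $e_{ij}$ denote the matrix units of $M_2(F)$. A linear operator $R\colon A\to A$ on an algebra $A$ over $F$ is a Rota--Baxter operator of weight $\Delta\in F$ if $R(x)R(y)=R(R(x)y+xR(y)+\Delta xy)$ for all $x,y\in A$. A Rota--Baxter operator $R$ of weight $\Delta$ on $A$ is called splitting if there are subalgebras $A_1,A_2$ of $A$ (possibly zero) such that $A=A_1\oplus A_2$ as vector spaces and $R(x_1+x_2)=-\Delta x_2$ for all $x_1\in A_1$, $x_2\in A_2$. *)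

(* Defs.v *)
From HB Require Import structures.
From mathcomp Require Import all_boot all_order all_algebra all_field.

Set Implicit Arguments.
Unset Strict Implicit.
Unset Printing Implicit Defensive.

Import GRing.Theory.
Local Open Scope ring_scope.

Section RotaBaxter.
Variables (F : fieldType) (A : falgType F).
Implicit Types (U : {vspace A}) (R : 'End(A)) (Delta : F).

Definition rota_baxter Delta R : Prop :=
  forall x y : A, R x * R y = R (R x * y + x * R y + Delta *: (x * y)).

Definition rota_baxter_on U Delta R : Prop :=
  (R @: U <= U)%VS /\
  {in U &, forall x y, R x * R y = R (R x * y + x * R y + Delta *: (x * y))}.

(* Weaker than [is_aspace U], which also requires a nonzero identity element:
   here U may be nonunital or zero. *)
Definition is_subalgebra U : bool := (U * U <= U)%VS.

Definition splitting Delta R : Prop :=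
  exists A1 A2 : {vspace A},
    [/\ is_subalgebra A1, is_subalgebra A2,
        (A1 + A2)%VS = fullv, directv (A1 + A2)
      & forall x1 x2, x1 \in A1 -> x2 \in A2 ->
          R (x1 + x2) = - (Delta *: x2)].

End RotaBaxter.

Section MatrixUnits.
Variable F : fieldType.

(* Indices start at 0: the matrix unit e_ij is [delta_mx (i-1) (j-1)]. *)
Definition e11 : 'M[F]_2 := delta_mx 0 0.
Definition e12 : 'M[F]_2 := delta_mx 0 1.
Definition e21 : 'M[F]_2 := delta_mx 1 0.
Definition e22 : 'M[F]_2 := delta_mx 1 1.

Definition diagD : {vspace 'M[F]_2} := <<[:: e11; e22]>>%VS.

End MatrixUnits.

Arguments e11 {F}.
Arguments e12 {F}.
Arguments e21 {F}.
Arguments e22 {F}.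
Arguments diagD {F}.

(* Main.v *)
Require Import Defs.
From mathcomp Require Import all_boot all_order all_algebra all_field.
From mathcomp Require Import ring.
Import GRing.Theory.
Local Open Scope ring_scope.

(** Dividing by Delta, take Q of weight 1 and P = Q + 1; if Q^2 = -Q then
    Q splits along ker Q and ker P. The images of P and of -Q are subalgebras
    which cannot both contain 1; as -1 - Q is again Rota-Baxter, assume 1 is
    not in the image of P. By Cayley-Hamilton that image then consists of
    singular matrices, so after a conjugation, and possibly a transposition,
    every P x has zero second column. If Q were injective, ker P would be a
    nonzero ideal of the simple algebra M_2, so ker Q <> 0; ker Q is an ideal of
    the image of P, which forces e21 in ker Q unless Q^2 = -Q. The Rota-Baxter
    identity on e11, e12, e22 then leaves, up to conjugation by a lower
    unitriangular matrix, a single operator, and it has the stated form. *)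

(** * Explicit two-by-two matrices in coordinates *)

Section TwoByTwo.
Variable F : fieldType.
Implicit Types (a b c d t : F) (x y : 'M[F]_2).

Definition mx2 a b c d : 'M[F]_2 :=
  \matrix_(i, j) if i == 0 then (if j == 0 then a else b)
                 else (if j == 0 then c else d).

Lemma mx2P x y :
  [/\ x 0 0 = y 0 0, x 0 1 = y 0 1, x 1 0 = y 1 0 & x 1 1 = y 1 1] <-> x = y.
Proof.
split=> [[E00 E01 E10 E11]|-> //]; apply/matrixP=> i j.
by case: (unliftP 0 i) => [i'|] ->; case: (unliftP 0 j) => [j'|] ->;
   rewrite ?(ord1 i') ?(ord1 j') ?lift0E // -?[lift 0 0]/(1 : 'I_2);
   have -> : lift 0 0 = 1 :> 'I_2 by apply/val_inj.
Qed.

Lemma mx2_eta x : x = mx2 (x 0 0) (x 0 1) (x 1 0) (x 1 1).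
Proof. by apply/mx2P; rewrite !mxE. Qed.

Lemma mx2_inj {a b c d a' b' c' d'} :
  mx2 a b c d = mx2 a' b' c' d' -> [/\ a = a', b = b', c = c' & d = d'].
Proof. by move/mx2P; rewrite !mxE. Qed.

Lemma mx2D a b c d a' b' c' d' :
  mx2 a b c d + mx2 a' b' c' d' = mx2 (a + a') (b + b') (c + c') (d + d').
Proof. by apply/mx2P; rewrite !mxE. Qed.

Lemma mx2N a b c d : - mx2 a b c d = mx2 (- a) (- b) (- c) (- d).
Proof. by apply/mx2P; rewrite !mxE. Qed.

Lemma mx2Z t a b c d : t *: mx2 a b c d = mx2 (t * a) (t * b) (t * c) (t * d).
Proof. by apply/mx2P; rewrite !mxE. Qed.

Lemma mulmx2E x y i j : (x * y) i j = x i 0 * y 0 j + x i 1 * y 1 j.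
Proof.
rewrite -mulmxE mxE big_ord_recl big_ord1; congr (_ + x i _ * y _ j);
exact/val_inj.
Qed.

Lemma mx2M a b c d a' b' c' d' :
  mx2 a b c d * mx2 a' b' c' d' =
  mx2 (a * a' + b * c') (a * b' + b * d') (c * a' + d * c') (c * b' + d * d').
Proof. by apply/mx2P; rewrite !mulmx2E !mxE. Qed.

Lemma mx2_1 : 1 = mx2 1 0 0 1.
Proof. by apply/mx2P; rewrite !mxE. Qed.

Lemma mx2_0 : 0 = mx2 0 0 0 0.
Proof. by apply/mx2P; rewrite !mxE. Qed.

Lemma e11E : e11 = mx2 1 0 0 0.
Proof. by apply/mx2P; rewrite !mxE. Qed.

Lemma e12E : e12 = mx2 0 1 0 0.
Proof. by apply/mx2P; rewrite !mxE. Qed.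

Lemma e21E : e21 = mx2 0 0 1 0.
Proof. by apply/mx2P; rewrite !mxE. Qed.

Lemma e22E : e22 = mx2 0 0 0 1.
Proof. by apply/mx2P; rewrite !mxE. Qed.

Lemma det_mx2 x : \det x = x 0 0 * x 1 1 - x 0 1 * x 1 0.
Proof.
rewrite (expand_det_row _ 0) big_ord_recl big_ord1 /cofactor !det_mx11 !mxE /=.
have -> : lift 0 0 = 1 :> 'I_2 by apply/val_inj.
have -> : lift 1 0 = 0 :> 'I_2 by apply/val_inj.
by rewrite /= addn0 add0n expr0 expr1; ring.
Qed.

Lemma mem_diagD x : (x \in diagD) = (x 0 1 == 0) && (x 1 0 == 0).
Proof.
rewrite /diagD span_cons span_seq1; apply/idP/andP.
  case/memv_addP=> _ /vlineP[a ->] [_ /vlineP[b ->] ->].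
  by rewrite e11E e22E !mx2Z mx2D !mxE /= !mulr0 addr0.
move=> [/eqP x01 /eqP x10].
have -> : x = x 0 0 *: e11 + x 1 1 *: e22.
  rewrite {1}[x]mx2_eta e11E e22E !mx2Z mx2D !mulr0 !mulr1 x01 x10.
  by rewrite !(add0r, addr0).
by rewrite memv_add // memvZ ?memv_line.
Qed.

End TwoByTwo.

Arguments mx2 {F}.

(** Lets [ring] derive one polynomial equation from another: only the identity between the two
    differences remains to be checked. *)
Lemma eq_of_subr {V : zmodType} (x y : V) {u v : V} :
  u = v -> x - y = u - v -> x = y.
Proof. by move=> -> /eqP; rewrite subrr subr_eq0 => /eqP. Qed.

(** * Weight-one operators for which the image of 1 + Q has zero second column *)

Section RotaBaxterMatrix2.
Variable F : fieldType.
Implicit Types (Q : 'End('M[F]_2)).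

(** Simplicity of the matrix algebra: sandwiching [x] between matrix units isolates a nonzero entry
    and moves it to any position. *)
Lemma ideal_full n (I : {vspace 'M[F]_n.+1}) (x : 'M[F]_n.+1) :
  (forall y z, y \in I -> y * z \in I) -> (forall y z, y \in I -> z * y \in I) ->
  x \in I -> x != 0 -> forall y, y \in I.
Proof.
move=> Ir Il Ix /matrix0Pn[i [j xij]] y.
rewrite (matrix_sum_delta y); apply: memv_suml => k _; apply: memv_suml => l _.
apply: memvZ; rewrite -[delta_mx k l](scalerK xij); apply: memvZ.
suff <- : delta_mx k i * x * delta_mx j l = x i j *: delta_mx k l.
  exact/Ir/Il.
rewrite -!mulmxE -(mul_delta_mx (0 : 'I_1)) -(mulmxA (delta_mx k 0)) -rowE.
rewrite -[delta_mx j l](mul_delta_mx (0 : 'I_1)) mulmxA -(mulmxA _ (row i x)) -colE.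
by rewrite (mx11_scalar (col j _)) !mxE mul_mx_scalar -scalemxAl mul_delta_mx.
Qed.

(* For [t = 0] this is triangular; the others are its conjugates by the
   lower unitriangular matrices. *)
Definition column_form (t : F) Q :=
  forall a b c d, Q (mx2 a b c d) = mx2 (t * b - d - a) (- b) (- t * a) (- d).

Lemma column_case Q : rota_baxter 1 Q -> (forall x i, (x + Q x) i 1 = 0) ->
  ~ (forall x, Q (Q x) = - Q x) -> exists t, column_form t Q.
Proof.
move=> RB col1 nsplit.
have [n Qn0 nn0] : exists2 n, Q n = 0 & n != 0.
  have [/eqP kQ|kQ] := eqVneq (lker Q) 0%VS; last first.
    exists (vpick (lker Q)); rewrite ?vpick0 //.
    by apply/eqP; rewrite -memv_ker memv_pick.
  case: nsplit => x.
  have surjQ z : exists w, z = Q w.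
    have : z \in limg Q by rewrite (lker0_limgf kQ) memvf.
    by case/memv_imgP=> w _; exists w.
  pose p := (\1 + Q)%VF.
  have in_kp y : (y \in lker p) = (Q y == - y).
    by rewrite memv_ker add_lfunE id_lfunE addrC addr_eq0.
  have kp : lker p != 0%VS.
    apply/negP=> /lker0_limgf fp; have : 1 \in limg p by rewrite fp memvf.
    case/memv_imgP=> y _; rewrite add_lfunE id_lfunE => /mx2P[_ _ _ /eqP].
    by rewrite col1 mx2_1 mxE /= oner_eq0.
  (* For Q y = -y the identity on (y, w) collapses to -(y * Q w) = Q (y * Q w), and likewise on the
     other side. Every z is some Q w, so [lker p] is a two-sided ideal. *)
  have : x \in lker p.
    apply: (ideal_full _ _ (vpick (lker p))); rewrite ?memv_pick ?vpick0 //.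
      move=> y z; rewrite !in_kp => /eqP Qy; have [w ->] := surjQ z.
      have := RB y w; rewrite Qy scale1r addrAC !mulNr addNr add0r.
      by move=> <-.
    move=> y z; rewrite !in_kp => /eqP Qy; have [w ->] := surjQ z.
    have := RB w y; rewrite Qy scale1r !mulrN addrNK => <- //.
  by rewrite in_kp => /eqP Qx; rewrite {1}Qx linearN.
(* Among matrices with zero second column, right multiplication is scaling by the top left entry.
   This applies to [n], since n = n + Q n. *)
have pM x y : (x + Q x) * (y + Q y) = (y + Q y) 0 0 *: (x + Q x).
  move: (col1 x 0) (col1 x 1) (col1 y 0) (col1 y 1).
  move: (x + Q x) (y + Q y) => {}x {}y; rewrite [x]mx2_eta [y]mx2_eta !mxE /=.
  by move=> -> -> -> ->; rewrite mx2M mx2Z; congr mx2; ring.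
(* If [n 0 0 != 0], multiplying [n] by [x + Q x] puts the whole image of
   [\1 + Q] into [lker Q]. *)
have n00 : n 0 0 = 0.
  apply/eqP/negPn/negP=> n00; apply: nsplit => x.
  have := RB x n; rewrite Qn0 mulr0 mulr0 addr0 scale1r -mulrDl [Q x + x]addrC.
  have -> : (x + Q x) * n = n 0 0 *: (x + Q x) by have := pM x n; rewrite Qn0 addr0.
  rewrite linearZ linearD /= => /esym/eqP; rewrite scaler_eq0 (negPf n00) /=.
  by rewrite addrC addr_eq0 => /eqP.
have Qe21 : Q (mx2 0 0 1 0) = 0.
  have := col1 n 0; have := col1 n 1; rewrite Qn0 addr0 => n11 n01.
  have nE : n = n 1 0 *: mx2 0 0 1 0.
    by rewrite {1}[n]mx2_eta n00 n01 n11 mx2Z !mulr0 mulr1.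
  have n10 : n 1 0 != 0.
    by apply: contraNneq nn0 => n10; rewrite nE n10 scale0r.
  by move/eqP: Qn0; rewrite nE linearZ scaler_eq0 (negPf n10) => /eqP.
(* The first column of [x + Q x], the only nonzero one, as a linear function
   of [x]; its value at [e21] is known from [Qe21]. *)
pose f11 := (mx2 1 0 0 0 + Q (mx2 1 0 0 0)) 0 0.
pose f12 := (mx2 0 1 0 0 + Q (mx2 0 1 0 0)) 0 0.
pose f22 := (mx2 0 0 0 1 + Q (mx2 0 0 0 1)) 0 0.
pose g11 := (mx2 1 0 0 0 + Q (mx2 1 0 0 0)) 1 0.
pose g12 := (mx2 0 1 0 0 + Q (mx2 0 1 0 0)) 1 0.
pose g22 := (mx2 0 0 0 1 + Q (mx2 0 0 0 1)) 1 0.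
have QE a b c d : Q (mx2 a b c d) =
    mx2 (f11 * a + f12 * b + f22 * d - a) (- b) (g11 * a + g12 * b + g22 * d) (- d).
  have -> : mx2 a b c d = a *: mx2 1 0 0 0 + b *: mx2 0 1 0 0 + c *: mx2 0 0 1 0
     + d *: mx2 0 0 0 1 by rewrite !mx2Z !mx2D; congr mx2; ring.
  rewrite !linearD !linearZ /= Qe21.
  have Q11 := mx2_eta F (mx2 1 0 0 0 + Q (mx2 1 0 0 0)).
  have Q12 := mx2_eta F (mx2 0 1 0 0 + Q (mx2 0 1 0 0)).
  have Q22 := mx2_eta F (mx2 0 0 0 1 + Q (mx2 0 0 0 1)).
  move: Q11 Q12 Q22; rewrite !col1.
  rewrite -/f11 -/f12 -/f22 -/g11 -/g12 -/g22.
  do 3! move/(canRL (addKr _)) ->.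
  by rewrite scaler0 addr0 !mx2N !(mx2D, mx2Z); congr mx2; ring.
clearbody f11 f12 f22 g11 g12 g22.
(* Equivalently 1 + Q does not kill the matrix 1: if Q 1 = -1, the identity on (1, y) becomes Q (Q
   y) = - Q y. *)
have p1 : ~ (f11 = - f22 /\ g11 = - g22).
  case=> pf pg; apply: nsplit => y.
  have Q1 : Q 1 = -1 by rewrite mx2_1 QE mx2N; congr mx2; ring: pf pg.
  have := RB 1 y; rewrite Q1 !mulN1r scale1r !mul1r.
  by rewrite addrAC addNr add0r => <-.
(* P = 1 + Q satisfies the identity with weight -1. Here (p, q) and (p', q') are the first columns
   of P x and P y, the z's are the entries of P x * y + x * P y - x * y, and the conclusion compares
   first columns. It is then evaluated on pairs of matrix units. *)
have E a b c d a' b' c' d' :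
  let p := f11 * a + f12 * b + f22 * d in
  let q := g11 * a + g12 * b + c + g22 * d in
  let p' := f11 * a' + f12 * b' + f22 * d' in
  let q' := g11 * a' + g12 * b' + c' + g22 * d' in
  let z00 := p * a' + (a * p' + b * q') - (a * a' + b * c') in
  let z01 := p * b' - (a * b' + b * d') in
  let z10 := q * a' + (c * p' + d * q') - (c * a' + d * c') in
  let z11 := q * b' - (c * b' + d * d') in
  f11 * z00 + f12 * z01 + f22 * z11 = p * p' /\
  g11 * z00 + g12 * z01 + z10 + g22 * z11 = q * p'.
  have := RB (mx2 a b c d) (mx2 a' b' c' d').
  rewrite scale1r !QE !mx2M !mx2D !QE => /mx2_inj[H1 _ H2 _] /=; split.
    apply: (eq_of_subr _ _ (esym H1)); ring.
  apply: (eq_of_subr _ _ (esym H2)); ring.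
have /=[H1 H2] := E 0 1 0 0 0 1 0 0.
have A : g12 * (f11 + f22) = 0 by apply: (eq_of_subr _ _ H1); ring.
have B : g12 * (g11 + g22) = 0 by apply: (eq_of_subr _ _ H2); ring.
clear H1 H2.
have {A B} g12_0 : g12 = 0.
  apply/eqP/negPn/negP=> g12n0; apply: p1; split; apply/eqP; rewrite -addr_eq0.
    by move/eqP: A; rewrite mulf_eq0 (negPf g12n0).
  by move/eqP: B; rewrite mulf_eq0 (negPf g12n0).
subst g12.
have /=[H1 H2] := E 1 0 0 0 1 0 0 0.
have f11_01 : f11 * (f11 - 1) = 0 by apply: (eq_of_subr _ _ H1); ring.
have fg11 : f11 * g11 = 0 by apply: (eq_of_subr _ _ H2); ring.
clear H1 H2.
have /=[H1 H2] := E 0 0 0 1 0 0 0 1.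
have f22_01 : f22 * (f22 + 1) = 0 by apply: (eq_of_subr _ _ (esym H1)); ring.
have fg22 : f22 * g22 = 0 by apply: (eq_of_subr _ _ (esym H2)); ring.
clear H1 H2.
have /=[H1 H2] := E 1 0 0 0 0 1 0 0.
have C : f12 * (f11 - 1) + g11 * f22 = 0 by apply: (eq_of_subr _ _ H1); ring.
clear H1 H2.
have /=[H1 H2] := E 0 1 0 0 0 0 0 1.
have G : g22 * f11 - f12 - f12 * f22 = 0 by apply: (eq_of_subr _ _ H1); ring.
clear H1 H2.
have /=[H1 H2] := E 0 0 0 1 0 1 0 0.
have H : g22 * (g22 - f12) = 0 by apply: (eq_of_subr _ _ H2); ring.
clear H1 H2.
have /=[H1 H2] := E 0 1 0 0 1 0 0 0.
have K : g11 * (g11 + f12) = 0 by apply: (eq_of_subr _ _ H2); ring.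
clear H1 H2.
(* Four cases, f11 being 0 or 1 and f22 being 0 or -1. If f22 = 0, both values of f11 give Q^2 = -Q;
   f22 = -1 with f11 = 1 contradicts [p1]; the remaining case is the column form with t = f12. *)
move/eqP: f22_01; rewrite mulf_eq0 => /orP[/eqP f22_0|];
  last rewrite addr_eq0 => /eqP f22_1.
  case: nsplit => x; rewrite [x]mx2_eta !QE mx2N.
  have f12E : f12 = g22 * f11.
    by apply: (eq_of_subr _ _ (esym G)); rewrite f22_0; ring.
  move/eqP: f11_01; rewrite mulf_eq0 => /orP[/eqP f11_0|];
    last rewrite subr_eq0 => /eqP f11_1.
    have f12_0 : f12 = 0 by rewrite f12E f11_0 mulr0.
    have g22_0 : g22 = 0.
      by apply/eqP; move/eqP: H; rewrite f12_0 subr0 mulf_eq0 orbb.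
    have g11_0 : g11 = 0.
      by apply/eqP; move/eqP: K; rewrite f12_0 addr0 mulf_eq0 orbb.
    by subst; congr mx2; ring.
  have g11_0 : g11 = 0 by move: fg11; rewrite f11_1 mul1r.
  by rewrite f12E f22_0 f11_1 g11_0; congr mx2; ring.
have g22_0 : g22 = 0.
  by apply/eqP; move/eqP: fg22; rewrite f22_1 mulN1r oppr_eq0.
move/eqP: f11_01; rewrite mulf_eq0 => /orP[/eqP f11_0|];
  last rewrite subr_eq0 => /eqP f11_1.
  have g11E : g11 = - f12.
    by apply: (eq_of_subr _ _ (esym C)); rewrite f11_0 f22_1; ring.
  exists f12 => a b c d; rewrite QE f11_0 f22_1 g22_0 g11E; congr mx2; ring.
have g11_0 : g11 = 0 by move: fg11; rewrite f11_1 mul1r.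
by case: p1; rewrite f11_1 f22_1 g11_0 g22_0 opprK oppr0.
Qed.

(** * Three symmetries of the problem: conjugation, transposition and flip *)

Definition conjop (S : 'M[F]_2) Q : 'End('M[F]_2) :=
  (amulr S \o amull (S^-1)%R \o Q \o amulr (S^-1)%R \o amull S)%VF.

Definition trop Q : 'End('M[F]_2) := linfun (trmx \o Q \o trmx).

(** An involution that exchanges Q with -(1 + Q), hence the images of Q and 1 + Q, and the
    eigenvalues 0 and -1. *)
Definition flip Q : 'End('M[F]_2) := (- \1 - Q)%VF.

Lemma conjopE S Q x : conjop S Q x = S^-1 * Q (S * x * S^-1) * S.
Proof. by rewrite /conjop /amull /amulr !comp_lfunE !lfunE /=. Qed.

Lemma tropE Q x : trop Q x = (Q x^T)^T.
Proof. by rewrite /trop lfunE /=. Qed.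

Lemma flipE Q x : flip Q x = - x - Q x.
Proof. by rewrite add_lfunE !opp_lfunE id_lfunE. Qed.

Lemma rota_baxter_conjop S Q :
  S \is a GRing.unit -> rota_baxter 1 Q -> rota_baxter 1 (conjop S Q).
Proof.
move=> uS RB x y; rewrite !conjopE.
have -> : S^-1 * Q (S * x * S^-1) * S * (S^-1 * Q (S * y * S^-1) * S)
  = S^-1 * (Q (S * x * S^-1) * Q (S * y * S^-1)) * S.
  by rewrite -!mulrA mulVKr.
rewrite RB; congr (_ * Q _ * _); rewrite !scale1r !mulrDr !mulrDl -!mulrA.
by rewrite !(mulVKr uS, mulKr uS) mulrV // mulr1.
Qed.

(** Transposition reverses products, and the identity keeps its form in the opposite algebra. *)
Lemma rota_baxter_trop Q : rota_baxter 1 Q -> rota_baxter 1 (trop Q).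
Proof.
move=> RB x y; rewrite !tropE -!mulmxE -trmx_mul mulmxE RB; congr (Q _)^T.
rewrite !scale1r !linearD /= !trmx_mul !trmxK -!mulmxE.
by congr (_ + _); rewrite addrC.
Qed.

Lemma rota_baxter_flip Q : rota_baxter 1 Q -> rota_baxter 1 (flip Q).
Proof.
move=> RB x y; rewrite !flipE scale1r.
have -> : (- x - Q x) * y + x * (- y - Q y) + x * y
          = - (Q x * y + x * Q y + 1 *: (x * y)).
  rewrite mulrDl mulrDr !mulrN !mulNr [- (x * y) - x * Q y]addrC addrA addrNK.
  by rewrite scale1r -!opprD -addrA addrC.
have QN z : Q (- z) = - Q z by exact: linearN.
rewrite QN -RB !opprK scale1r -!opprD mulrNN mulrDl !mulrDr.
by rewrite addrA; congr (_ + _); rewrite addrC [x * y + _]addrC addrA.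
Qed.

Definition triangular (P : 'M[F]_2 -> 'M[F]_2) :=
  ((P e12 = 0 /\ P e21 = - e21) \/ (P e21 = 0 /\ P e12 = - e12)) /\
  (P e11 \in diagD /\ P e22 \in diagD).

Definition triangularizable Q :=
  exists2 S : 'M[F]_2, S \is a GRing.unit & triangular (conjop S Q).

Lemma triangularizable_conjop S Q :
  S \is a GRing.unit -> triangularizable (conjop S Q) -> triangularizable Q.
Proof.
move=> uS [T uT tri]; exists (S * T); first by rewrite unitrMl.
have -> // : conjop (S * T) Q = conjop T (conjop S Q).
by apply/lfunP=> x; rewrite !conjopE invrM // !mulrA.
Qed.

(** Transposing swaps [e12] and [e21], hence the two alternatives of [triangular], and turns
    conjugation by S into conjugation by the inverse transpose. *)
Lemma triangularizable_trop Q : triangularizable (trop Q) -> triangularizable Q.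
Proof.
case=> S uS tri; exists (S^T)^-1.
  by rewrite unitrV; exact: etrans (unitmx_tr S) uS.
have conjT x : conjop (S^T)^-1 Q x = (conjop S (trop Q) x^T)^T.
  rewrite !conjopE tropE invrK -!mulmxE !trmx_mul trmxK.
  by rewrite -[S^-1]/(invmx S) trmx_inv !trmxK !mulmxA.
have diagT x : (x^T \in diagD) = (x \in diagD).
  by rewrite !mem_diagD !mxE andbC.
case: tri => tri [D1 D2]; rewrite /triangular !conjT !trmx_delta !diagT.
split=> //; case: tri => [[-> ->]|[-> ->]]; [right|left];
  by rewrite linearN /= trmx0 trmx_delta.
Qed.

Lemma triangularizable_flip Q : triangularizable (flip Q) -> triangularizable Q.
Proof.
case=> S uS tri; exists S => //.
have conjF x : conjop S Q x = - x - conjop S (flip Q) x.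
  rewrite !conjopE flipE mulrDr mulrDl !(mulrN, mulNr) opprD !opprK.
  by rewrite -!mulrA mulKr // mulVr // mulr1 addKr.
case: tri => tri [D1 D2]; rewrite /triangular !conjF.
split; last first.
  by split; rewrite rpredB // rpredN mem_diagD ?e11E ?e22E !mxE /= eqxx.
case: tri => [[-> ->]|[-> ->]]; [right|left];
  by rewrite opprK addNr subr0.
Qed.

Lemma column_form_triangularizable t Q : column_form t Q -> triangularizable Q.
Proof.
move=> QE; pose S := mx2 1 0 t 1.
have SV : S * mx2 1 0 (- t) 1 = 1.
  by rewrite mx2M mx2_1; congr mx2; ring.
have uS : S \is a GRing.unit.
  apply/unitrP; exists (mx2 1 0 (- t) 1); split=> //.
  by rewrite mx2M mx2_1; congr mx2; ring.
have VS : S^-1 = mx2 1 0 (- t) 1 by rewrite -[LHS]mulr1 -SV mulKr.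
exists S => //; rewrite /triangular !mem_diagD !conjopE VS e11E e12E e21E e22E.
rewrite !mx2M !QE !mx2M !mxE /=.
split; last by split; apply/andP; split; apply/eqP; ring.
by right; rewrite mx2_0 mx2N; split; congr mx2; ring.
Qed.

(** * Linear spaces of singular matrices: a common kernel vector or a common image line *)

Lemma singular_space (p : 'End('M[F]_2)) : (forall x, \det (p x) = 0) ->
  exists2 S : 'M[F]_2, S \is a GRing.unit &
    (forall x i, (S^-1 * p x * S) i 1 = 0) \/ (forall x j, (S^-1 * p x * S) 1 j = 0).
Proof.
move=> det0.
have [p0|] := eqVneq p 0.
  by exists 1; [exact: unitr1 | left=> x i; rewrite p0 lfunE mulr0 mul0r mxE].
case/lfunPn=> a; rewrite zero_lfunE => pa0.
pose L := col_ebase (p a); pose M := row_ebase (p a).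
have uL : L \is a GRing.unit by exact: col_ebase_unit.
have uM : M \is a GRing.unit by exact: row_ebase_unit.
have rk1 : \rank (p a) = 1%N.
  have := rank_leq_row (p a); rewrite leq_eqVlt ltnS => /orP[/eqP r2|].
    have : row_free (p a) by rewrite /row_free r2.
    by rewrite row_free_unit unitmxE det0 unitr0.
  by rewrite leq_eqVlt ltnS leqn0 mxrank_eq0 (negPf pa0) orbF => /eqP.
(* Rank normalisation turns one nonzero value p a into [e11]. Comparing the determinants of N x and
   e11 + N x then kills the entry (1, 1), so the two off-diagonal entries have product zero. *)
pose N x := L^-1 * p x * M^-1.
have Na : N a = mx2 1 0 0 0.
  rewrite /N -[p a]mulmx_ebase rk1 !mulmxE -/L -/M -!mulrA mulKr // mulrV // mulr1.
  by apply/mx2P; rewrite !mxE.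
have detN x : \det (N x) = 0 by rewrite /N -!mulmxE !det_mulmx det0 mulr0 mul0r.
have ND x y : N (x + y) = N x + N y by rewrite /N linearD mulrDr mulrDl.
have N11 x : N x 1 1 = 0.
  have := detN (a + x); have := detN x; rewrite ND Na !det_mx2 !mxE /=.
  by rewrite !add0r mulrDl mul1r -addrA => ->; rewrite addr0.
have N01_10 x : N x 0 1 * N x 1 0 = 0.
  have := detN x; rewrite det_mx2 N11 mulr0 sub0r => /eqP.
  by rewrite oppr_eq0 => /eqP.
(* Encodes x -> N x 0 1 as a linear operator, so that it either is zero or has a witness [b] of
   nonvanishing. *)
pose h : 'End('M[F]_2) :=
  (amulr e22 \o amull e11 \o amulr (M^-1)%R \o amull (L^-1)%R \o p)%VF.
have hE x : h x = mx2 0 (N x 0 1) 0 0.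
  rewrite /h /amull /amulr !comp_lfunE !lfunE /= -/(N x).
  by rewrite [N x]mx2_eta e11E e22E !mx2M !mxE /=; congr mx2; ring.
have [h0|/lfunPn[b]] := eqVneq h 0; last rewrite hE zero_lfunE => hb.
  have N01 x : N x 0 1 = 0.
    by have := hE x; rewrite h0 zero_lfunE => /mx2P[_]; rewrite !mxE /=.
  (* Conjugating p x by this S gives M * L * N x, and left multiplication preserves a zero second
     column. In the other case S = L gives N x * M * L, preserving a zero second row. *)
  exists M^-1; first by rewrite unitrV.
  left=> x i; rewrite invrK -mulrA -[p x](mulVKr uL) -mulrA -/(N x).
  by rewrite mulrA mulmx2E N01 N11 !mulr0 addr0.
have Nb01 : N b 0 1 != 0.
  by apply: contraNneq hb => ->; rewrite mx2_0.
have Nb10 : N b 1 0 = 0.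
  by apply/eqP; have /eqP := N01_10 b; rewrite mulf_eq0 (negPf Nb01).
exists L => //; right=> x j.
have N10 : N x 1 0 = 0.
  have := N01_10 (b + x); rewrite ND [X in X * _]mxE [X in _ * X]mxE Nb10.
  rewrite add0r mulrDl N01_10 addr0.
  by move/eqP; rewrite mulf_eq0 (negPf Nb01) => /eqP.
rewrite -[L^-1 * p x](mulrVK uM) -/(N x) -mulrA.
by rewrite mulmx2E N10 N11 !mul0r addr0.
Qed.

(** The image is closed under products, so by Cayley-Hamilton it contains det (Q x) times 1. *)
Lemma singular_limg Q : rota_baxter 1 Q -> 1 \notin limg Q ->
  forall x, \det (Q x) = 0.
Proof.
move=> RB n1 x; apply: contraNeq n1 => det_n0.
rewrite -(scalerK det_n0 1) memvZ //.
have -> : \det (Q x) *: 1 = (Q x 0 0 + Q x 1 1) *: Q x - Q x * Q x.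
  move: (Q x) => y; rewrite (mx2_eta _ y) det_mx2 mx2_1 !mxE /=.
  by rewrite !mx2Z mx2M mx2N mx2D; congr mx2; ring.
by rewrite RB rpredB ?memvZ ?memv_img ?memvf.
Qed.

(** The operator Q^2 + Q is invariant under [flip]. *)
Lemma flip_antiidempotent Q :
  (forall x, flip Q (flip Q x) = - flip Q x) -> forall x, Q (Q x) = - Q x.
Proof.
move=> idF x; have := idF x; rewrite flipE => /eqP.
rewrite -subr_eq0 addrAC subrr sub0r oppr_eq0 flipE linearB linearN /=.
rewrite -opprD oppr_eq0 addrC.
by rewrite addr_eq0 => /eqP.
Qed.

Lemma triangularizable_of_singular Q : rota_baxter 1 Q ->
  ~ (forall x, Q (Q x) = - Q x) -> 1 \notin limg Q -> triangularizable Q.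
Proof.
(* [column_case] constrains 1 + Q, whereas here P itself has column values; [flip] bridges the two,
   as x + flip P x = - P x. *)
have col (P : 'End('M[F]_2)) : rota_baxter 1 P -> ~ (forall x, P (P x) = - P x) ->
    (forall (x : 'M[F]_2) i, (P x : 'M[F]_2) i 1 = 0) -> triangularizable P.
  move=> RB nid col1; apply: triangularizable_flip.
  have [x i||t] := column_case (flip P) (rota_baxter_flip _ RB).
  - by rewrite flipE addrA subrr add0r mxE col1 oppr0.
  - by move/flip_antiidempotent.
  exact: column_form_triangularizable.
move=> RB nid n1.
have [S uS cases] := singular_space _ (singular_limg _ RB n1).
apply: (triangularizable_conjop _ _ uS).
have RBS := rota_baxter_conjop _ _ uS RB.
have nidS : ~ (forall x, conjop S Q (conjop S Q x) = - conjop S Q x).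
  have SK x : S * (S^-1 * x * S) * S^-1 = x.
    by rewrite -!mulrA mulrV // mulr1 mulVKr.
  move=> idS; apply: nid => x; have := idS (S^-1 * x * S); rewrite !conjopE !SK.
  by rewrite -mulNr -mulrN => /(mulIr uS); apply: mulrI; rewrite unitrV.
case: cases => [col1|row1].
  by apply: col => // x i; rewrite conjopE.
apply: triangularizable_trop; apply: col; first exact: rota_baxter_trop.
  move=> idT; apply: nidS => x; have := idT x^T; rewrite !tropE !trmxK.
  by rewrite -linearN => /trmx_inj.
by move=> x i; rewrite tropE mxE conjopE.
Qed.

(** If Q y = 1 and Q x = -x - 1, the identity on (x, y) reads Q x = Q (x - y) = Q x - 1. *)
Lemma one_notin_limg Q : rota_baxter 1 Q ->
  (1 \notin limg Q) || (1 \notin limg (flip Q)).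
Proof.
move=> RB; rewrite -negb_and; apply/negP=> /andP[/memv_imgP[y _ Qy]].
case/memv_imgP=> x _; rewrite flipE => Qx.
have {}Qx : Q x = - x - 1 by rewrite Qx subKr.
have := RB x y; rewrite -Qy mulr1 scale1r mulr1 Qx mulrBl mul1r mulNr.
have -> : - (x * y) - y + x + x * y = x - y.
  by rewrite addrC !addrA subrr add0r addrC.
rewrite linearB /= -Qy Qx -{1}[- x - 1]addr0 => /addrI/eqP.
by rewrite eq_sym oppr_eq0 oner_eq0.
Qed.

(** * Splitting operators, inner automorphisms and the conclusion *)

Lemma splitting_of_quadratic (A : falgType F) Delta (R : 'End(A)) :
  Delta != 0 -> rota_baxter Delta R ->
  (forall x, R (R x) = - (Delta *: R x)) -> splitting Delta R.
Proof.
move=> Dn0 RB RR; pose K := (R + Delta *: \1)%VF.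
have KE x : (x \in lker K) = (R x == - (Delta *: x)).
  by rewrite memv_ker add_lfunE scale_lfunE id_lfunE addr_eq0.
exists (lker R), (lker K); split.
- apply/prodvP=> x y; rewrite !memv_ker => /eqP Rx /eqP Ry.
  have /esym := RB x y; rewrite Rx Ry !mul0r mulr0 !add0r linearZ /=.
  by move/eqP; rewrite scaler_eq0 (negPf Dn0).
- apply/prodvP=> x y; rewrite !KE => /eqP Rx /eqP Ry.
  have := RB x y; rewrite Rx Ry !mulrN !mulNr opprK -!scalerAl -!scalerAr.
  have RE z : R (- (Delta *: z)) = Delta *: - R z.
    by rewrite -scalerN linearZ /= linearN.
  by rewrite addrNK RE => /(scalerI Dn0) ->; rewrite opprK.
- apply/vspaceP=> x; rewrite memvf.
  (* The components of x in the eigenspaces for 0 and -Delta, since R is annihilated by X (X +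
     Delta). *)
  have -> : x = Delta^-1 *: (Delta *: x + R x) + Delta^-1 *: - R x.
    by rewrite -scalerDr addrK scalerK.
  apply: memv_add; rewrite memvZ ?memvN //.
    by rewrite memv_ker linearD linearZ /= RR subrr.
  by rewrite KE RR.
- apply/directv_addP/eqP; rewrite -subv0; apply/subvP=> x.
  rewrite memv_cap KE memv_ker => /andP[/eqP ->].
  by rewrite eq_sym oppr_eq0 scaler_eq0 (negPf Dn0) memv0.
- move=> x y; rewrite KE memv_ker linearD /= => /eqP -> /eqP ->.
  by rewrite add0r.
Qed.

Lemma inner_aend (S : 'M[F]_2) : S \is a GRing.unit ->
  exists psi : 'AEnd('M[F]_2), forall x, psi x = S * x * S^-1.
Proof.
move=> uS; pose f : 'End('M[F]_2) := (amulr (S^-1)%R \o amull S)%VF.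
have fE x : f x = S * x * S^-1.
  by rewrite /f /amulr /amull comp_lfunE !lfunE.
have f_ahom : ahom_in fullv f.
  apply/ahomP_tmp; split=> [|x y]; rewrite !fE; first by rewrite mulr1 mulrV.
  by rewrite -!mulrA mulKr.
by exists (AHom f_ahom).
Qed.

End RotaBaxterMatrix2.

Theorem theorem3 (F : fieldType) (charF : 2%N \notin [pchar F])
    (Delta : F) (Delta_neq0 : Delta != 0)
    (R : 'End('M[F]_2)) (RB : rota_baxter Delta R) :
  splitting Delta R \/
  exists psi : 'AEnd('M[F]_2),
    bijective psi /\
    let P : 'End('M[F]_2) := (psi^-1 \o (Delta^-1 *: R) \o psi)%VF in
    [/\ rota_baxter 1 P,
        (P e12 = 0 /\ P e21 = - e21) \/ (P e21 = 0 /\ P e12 = - e12)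
      & rota_baxter_on diagD 1 P].
Proof.
pose Q : 'End('M[F]_2) := (Delta^-1 *: R)%VF.
have RBQ : rota_baxter 1 Q.
  move=> x y; rewrite !scale_lfunE -!scalerAl -!scalerAr.
  have -> : Delta^-1 *: (R x * y) + Delta^-1 *: (x * R y) + 1 *: (x * y)
            = Delta^-1 *: (R x * y + x * R y + Delta *: (x * y)).
    by rewrite !scalerDr scalerK // scale1r.
  by rewrite RB; congr (_ *: _); apply: esym; exact: linearZ.
have [idQ|/lfunPn nid] := eqVneq (Q \o Q)%VF (- Q)%VF.
  left; apply: splitting_of_quadratic => // x.
  have /lfunP/(_ x) := idQ; rewrite comp_lfunE opp_lfunE !scale_lfunE linearZ /= scalerA.
  move/(congr1 (fun z => Delta *: (Delta *: z))).
  by rewrite -scalerA !scalerN !(scalerKV Delta_neq0).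
right.
have nidQ : ~ (forall x, Q (Q x) = - Q x).
  move=> idQ; have [x] := nid; by rewrite comp_lfunE opp_lfunE idQ eqxx.
have [S uS [tri [D1 D2]]] : triangularizable _ Q.
  have /orP[n1|n1] := one_notin_limg _ _ RBQ.
    exact: triangularizable_of_singular.
  apply/triangularizable_flip/triangularizable_of_singular => //.
    exact: rota_baxter_flip.
  by move/flip_antiidempotent.
have [psi psiE] := inner_aend _ _ uS.
exists psi.
have psiK : cancel (fun x => S^-1 * x * S) psi.
  by move=> x; rewrite psiE -!mulrA mulrV // mulr1 mulVKr.
have Kpsi : cancel psi (fun x => S^-1 * x * S).
  by move=> x; rewrite psiE -!mulrA mulVr // mulr1 mulKr.
split; first by exists (fun x => S^-1 * x * S).
(* The inverse of a linear map cancels it on the left only when its kernel is trivial, which [Kpsi]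
   supplies. *)
have -> : (psi^-1 \o (Delta^-1 *: R) \o psi)%VF = conjop _ S Q.
  apply/lfunP=> x; rewrite conjopE !comp_lfunE psiE -[X in (psi^-1)%VF X]psiK.
  by rewrite lker0_lfunK //; apply/lker0P/can_inj/Kpsi.
have RBP := rota_baxter_conjop _ _ _ uS RBQ.
split=> //; split=> [|x y _ _]; last exact: RBP.
rewrite /diagD limg_span span_def /= !big_cons big_nil addv0 -?/diagD.
by rewrite subv_add -!memvE D1 D2.
Qed.
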